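(* $t(n)\in O\left(1.61^n\right)$.
   Context: Let $\mathfrak{C}=\{0,1\}^n$ be the vertex set of the $n$-dimensional hypercube; $\oplus,\wedge$ denote bitwise XOR and AND. An outmap is any function $s:\mathfrak{C}\to\{0,1\}^n$. A clash of $s$ is a pair of distinct vertices $u,v$ with $(s(u)\oplus s(v))\wedge(u\oplus v)=0^n$. A query at $u$ to the oracle for $s$ returns $s(u)$; algorithms choose queries adaptively, and only the number of queries is counted. \textsc{Sink-or-Clash}: given oracle access to an arbitrary outmap $s$, query either a vertex $u$ with $s(u)=0^n$ or both vertices of some clash. $t(n)=\min_{\mathcal A}\max_s t(\mathcal A,s)$, where $\mathcal A$ ranges over deterministic algorithms solving \textsc{Sink-or-Clash} on all outmaps of the $n$-cube and $t(\mathcal A,s)$ is the number of queries made on $s$. *)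

(* Defs.v *)
From mathcomp Require Import all_boot all_order all_algebra.
From mathcomp Require Import all_classical all_reals all_analysis.

Set Implicit Arguments.
Unset Strict Implicit.
Unset Printing Implicit Defensive.

(* Bit strings of length n: both the vertices of the n-cube and the values of
   an outmap. *)
Definition bits (n : nat) := {ffun 'I_n -> bool}.

Definition bxor n (x y : bits n) : bits n := [ffun i => x i (+) y i].
Definition band n (x y : bits n) : bits n := [ffun i => x i && y i].
Definition bzero n : bits n := [ffun=> false].

Definition outmap (n : nat) := {ffun bits n -> bits n}.

Definition sink n (s : outmap n) (u : bits n) : Prop := s u = bzero n.

Definition clash n (s : outmap n) (u v : bits n) : Prop :=
  u <> v /\ band (bxor (s u) (s v)) (bxor u v) = bzero n.

(* A deterministic adaptive query algorithm on the n-cube is a decision tree: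
   it halts, or queries a vertex and continues according to the answer.  Only
   the queried vertices matter in Sink-or-Clash, so halting returns no output.
   Answers range over a finite type, so a tree has bounded depth: every
   algorithm halts on every outmap. *)
Inductive algorithm (n : nat) : Type :=
| Halt
| Query (u : bits n) (next : bits n -> algorithm n).

Fixpoint queries n (A : algorithm n) (s : outmap n) : seq (bits n) :=
  if A is Query u next then u :: queries (next (s u)) s else [::].

Definition num_queries n (A : algorithm n) (s : outmap n) : nat :=
  size (queries A s).

Definition solves_sink_or_clash n (A : algorithm n) : Prop :=
  forall s : outmap n,
    (exists2 u, u \in queries A s & sink s u) \/
    (exists u v, [/\ u \in queries A s, v \in queries A s & clash s u v]).

Definition worst_case n (A : algorithm n) : nat :=
  \max_(s : outmap n) num_queries A s.

Definition achievable (n k : nat) : bool :=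
  `[< exists A : algorithm n, solves_sink_or_clash A /\ worst_case A = k >].

(* Querying every vertex succeeds: two vertices with the same image clash, and
   an injective outmap is onto, hence has a sink. *)
Lemma achievable_exists n : exists k, achievable n k.
Proof.
pose A : algorithm n :=
  foldr (fun u B => Query u (fun=> B)) (Halt n) (enum (bits n)).
have qA s : queries A s = enum (bits n).
  by rewrite /A; elim: (enum _) => //= u l ->.
exists (worst_case A); apply/asboolP; exists A; split=> // s; rewrite qA.
case: (pselect (exists u v, clash s u v)) => [[u [v cuv]]|ncl].
  by right; exists u, v; rewrite !mem_enum; split.
left; have inj_s : injective s.
  move=> u v eq_s; apply: contrapT => neq_uv; apply: ncl; exists u, v.
  by split=> //; apply/ffunP=> i; rewrite !ffunE eq_s addbb.
exists (invF inj_s (bzero n)); first by rewrite mem_enum.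
exact: f_invF.
Qed.

(* The minimum over solving algorithms of the worst-case number of queries. *)
Definition t (n : nat) : nat := ex_minn (achievable_exists n).

(* Main.v *)
(* The Fibonacci Seesaw of Szabo and Welzl.  Given the sinks of two antipodal
   i-dimensional faces of a d-dimensional face, either they clash or they are
   told apart by a coordinate j outside both faces; one of them then remains a
   sink in direction j, and one search in an i-dimensional face yields sinks of
   two antipodal (i+1)-dimensional faces.  At i = d - 4, representing every
   i-face by its sink leaves Sink-or-Clash on a 4-cube, with the answers at 0000
   and 1111 known; there five more queries suffice, namely 0011, 1100 and three
   that depend on the answers, whatever these are.
   With A d and F d the numbers of queries that reach two antipodal d-faces and
   that solve a d-face, A (d+1) = A d + F d and F (d+4) = A d + 5 F d, so that
   A d <= 4 r^d and F d <= 4 (r - 1) r^d for r = 1.61, because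
   1 + 5 (r - 1) <= (r - 1) r^4. *)
Require Import Defs.
From mathcomp Require Import all_boot all_order all_algebra.
From mathcomp Require Import all_classical all_reals all_analysis.
From mathcomp Require Import zify lra.
Import Order.TTheory GRing.Theory Num.Theory.
Import numFieldNormedType.Exports.
Local Open Scope classical_set_scope.
Local Open Scope ring_scope.

Set Implicit Arguments.
Unset Strict Implicit.
Unset Printing Implicit Defensive.

(** * Query games on transcripts *)

Section Game.
Local Open Scope nat_scope.

Definition transcript n := seq (bits n * bits n).

(* [T] extends, by at most [k] adaptive queries, to a transcript satisfying [G].
   The answers need not come from an outmap: a vertex queried twice may receive
   two answers. *)
Inductive can n (G : transcript n -> Prop) : nat -> transcript n -> Prop :=
| can_done k T : G T -> can G k T
| can_query k T u : (forall a, can G k ((u, a) :: T)) -> can G k.+1 T.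

Section Can.
Variable n : nat.
Implicit Types (G H : transcript n -> Prop) (T : transcript n).
Implicit Types (I J : {set 'I_n}) (x y z : bits n).

Lemma can_leq G k l T : k <= l -> can G k T -> can G l T.
Proof.
move=> + GT; elim: GT l => {k T} [k T GT l _|k T u _ IH [//|l] kl].
  exact: can_done.
by apply: (@can_query _ _ _ _ u) => a; apply: IH.
Qed.

(** The inclusion of [T] in [T'] keeps sinks found earlier available to later searches. *)
Lemma can_bind G H k m T : can G k T ->
    (forall T', {subset T <= T'} -> G T' -> can H m T') ->
  can H (k + m) T.
Proof.
elim=> {k T} [k T GT GH|k T u _ IH GH].
  by apply: (@can_leq _ m); [exact: leq_addl|exact: GH].
apply: (@can_query _ _ _ _ u) => a; apply: IH => T' sub; apply: GH => p pT.
by apply: sub; rewrite inE pT orbT.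
Qed.

Lemma can_algorithm G k T : can G k T -> exists A : algorithm n,
  forall s : outmap n, (forall p, p \in T -> p.2 = s p.1) ->
    num_queries A s <= k /\
    exists2 T', G T' & forall p, p \in T' ->
      p.2 = s p.1 /\ (p \in T \/ p.1 \in queries A s).
Proof.
elim=> {k T} [k T GT|k T u _ /choice [next IH]].
  exists (Halt n) => s sT; split=> //; exists T => // p pT.
  by split; [exact: sT|left].
exists (Query u next) => s sT.
have [|lek [T' GT' sT']] := IH (s u) s.
  by move=> p; rewrite inE => /orP[/eqP->|/sT].
split=> //; exists T' => // p /sT' [-> [pT|pq]]; split=> //.
  by move: pT; rewrite inE => /orP[/eqP->|pT]; [right; rewrite /= mem_head|left].
by right; rewrite /= inE pq orbT.
Qed.

(** * Clashes and sinks of faces *)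

Definition clashed T : Prop := exists p q,
  [/\ p \in T, q \in T, p.1 <> q.1 & band (bxor p.2 q.2) (bxor p.1 q.1) = bzero n].

Lemma clashed_or_separated T p q : p \in T -> q \in T -> p.1 != q.1 ->
  clashed T \/ exists2 i, p.1 i != q.1 i & p.2 i != q.2 i.
Proof.
move=> pT qT /eqP npq.
have [/existsP[i /andP[? ?]]|/existsPn nsep] :=
    boolP [exists i, (p.1 i != q.1 i) && (p.2 i != q.2 i)].
  by right; exists i.
left; exists p, q; split=> //; apply/ffunP => i; rewrite !ffunE andbC.
by rewrite -!negb_eqb; apply: negbTE; exact: nsep.
Qed.

(** A face is given by its set [I] of free coordinates and any one of its vertices [x]. *)
Definition agree_off I x y :=
  forall i, i \notin I -> y i = x i.
Definition zero_on I y :=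
  forall i, i \in I -> y i = false.

Definition face_sink I x (p : bits n * bits n) :=
  agree_off I x p.1 /\ zero_on I p.2.

Definition solved I x T := clashed T \/ exists2 p, p \in T & face_sink I x p.

Definition solvable d k := forall I x T, #|I| = d -> can (solved I x) k T.

Definition flip x j : bits n := [ffun i => x i (+) (i == j)].

Lemma zero_on_sep I y z i : zero_on I y -> zero_on I z -> y i != z i -> i \notin I.
Proof. by move=> y0 z0; apply: contra => iI; rewrite y0 ?z0. Qed.

Lemma solvable0 : solvable 0 1.
Proof.
move=> I x T /eqP; rewrite cards_eq0 => /eqP->.
apply: (@can_query _ _ _ _ x) => a; apply: can_done; right.
by exists (x, a); rewrite ?mem_head //; split=> // i; rewrite inE.
Qed.

(** The sinks of two opposite facets can be separated only in the direction [j] between them; then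
    exactly one of them is not outgoing in [j]. *)
Lemma solvableS d k : solvable d k -> solvable d.+1 (k + k).
Proof.
move=> sd I x T cI; have /card_gt0P[j jI] : 0 < #|I| by rewrite cI.
have cI' : #|I :\ j| = d by move: cI; rewrite (cardsD1 j) jI => -[].
apply: (can_bind (sd _ x _ cI')) => T' _ [cT|[p pT [px p0]]].
  by apply: can_done; left.
rewrite -[k]addn0; apply: (can_bind (sd _ (flip x j) _ cI')) => T'' sub.
case=> [cT|[q qT [qx q0]]]; apply: can_done; first by left.
have jp : p.1 j = x j by apply: px; rewrite !inE eqxx.
have jq : q.1 j = ~~ x j by rewrite qx ?ffunE ?eqxx ?addbT // !inE eqxx.
have npq : p.1 != q.1.
  by apply: contraTneq isT => e; move: jq; rewrite -e jp; case: (x j).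
case: (clashed_or_separated (sub _ pT) qT npq) => [|[i ip i2]]; first by left.
have iI := zero_on_sep p0 q0 i2.
have ij : i = j.
  apply: contraTeq ip => nij.
  by rewrite px // qx // ffunE (negbTE nij) addbF eqxx.
subst i; have fs y z : agree_off (I :\ j) y z -> agree_off I y z.
  by move=> yz i iI'; apply: yz; rewrite !inE (negbTE iI') andbF.
have zs y : zero_on (I :\ j) y -> y j = false -> zero_on I y.
  by move=> y0 yj i iI'; case: (eqVneq i j) => [->//|nij]; apply: y0; rewrite !inE nij.
right; case ep: (p.2 j); last first.
  by exists p; [exact: sub|split; [exact: fs|exact: zs]].
exists q => //; split; last by apply: zs => //; move: i2; rewrite ep; case: (q.2 j).
move=> i iI'; rewrite (fs _ _ qx) // ffunE.
by rewrite (_ : (i == j) = false) ?addbF //; apply: contraNF iI' => /eqP->.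
Qed.

Lemma solvable_exp d : solvable d (2 ^ d).
Proof.
by elim: d => [|d IH]; [exact: solvable0|rewrite expnS mul2n -addnn; exact: solvableS].
Qed.

(** * The seesaw between antipodal faces *)

(** Coordinates in [I] are unconstrained: the [I]-faces of the two sinks are antipodal, not the
    sinks themselves. *)
Definition antipodal_sinks J x (I : {set 'I_n}) (p q : bits n * bits n) :=
  [/\ agree_off J x p.1 /\ zero_on I p.2, agree_off J x q.1 /\ zero_on I q.2 &
      forall i, i \in J :\: I -> p.1 i != q.1 i].

Definition antipodal J x d T := clashed T \/ exists I p q,
  [/\ I \subset J, #|I| = d, p \in T, q \in T & antipodal_sinks J x I p q].

Definition reachable d k := forall J x T,
  d <= #|J| -> can (antipodal J x d) k T.

Lemma reachable0 : reachable 0 2.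
Proof.
move=> J x T _; apply: (@can_query _ _ _ _ x) => a.
pose y : bits n := [ffun i => x i (+) (i \in J)].
apply: (@can_query _ _ _ _ y) => b.
apply: can_done; right; exists finset.set0, (x, a), (y, b).
split; rewrite ?finset.sub0set ?cards0 ?inE ?eqxx ?orbT //.
have y0 (w : bits n) : zero_on finset.set0 w by move=> i; rewrite inE.
split=> /=; [by []| |]; [split=> // i /negbTE iJ | move=> i].
  by rewrite ffunE iJ addbF.
by rewrite !inE /= ffunE => ->; case: (x i).
Qed.

Lemma antipodal_sinksC J x I p q :
  antipodal_sinks J x I p q -> antipodal_sinks J x I q p.
Proof. by case=> ? ? d; split=> // i /d; rewrite eq_sym. Qed.

(* When the sink [p] stays a sink in direction [j], the sink [q] does not, so
   the sink of the face [I] on the other side of [q] extends to [j]. *)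
Lemma seesaw_step J x d k T I p q j : solvable d k ->
    I \subset J -> #|I| = d -> p \in T -> q \in T -> antipodal_sinks J x I p q ->
    j \in J :\: I -> p.2 j = false -> q.2 j ->
  can (antipodal J x d.+1) k T.
Proof.
move=> sd sIJ cI pT qT [[px p0] [qx q0] pq] jJI pj qj.
have [jI jJ] : j \notin I /\ j \in J by move: jJI; rewrite inE => /andP[].
rewrite -[k]addn0; apply: (can_bind (sd I (flip q.1 j) T cI)) => T' sub.
case=> [cT|[r rT [rx r0]]]; apply: can_done; first by left.
have rE i : i \notin I -> r.1 i = q.1 i (+) (i == j).
  by move=> iI; rewrite rx // ffunE.
have nrq : r.1 != q.1.
  by apply: contraTneq isT => e; move: (rE j jI); rewrite e eqxx; case: (q.1 j).
case: (clashed_or_separated rT (sub _ qT) nrq) => [|[i i1 i2]]; first by left.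
have iI := zero_on_sep r0 q0 i2.
(* The faces of [r] and [q] are adjacent in direction [j], so only [j] can separate the two sinks;
   as [q] is outgoing there, [r] is not. *)
have ij : i = j.
  by apply: contraTeq i1 => nij; rewrite rE // (negbTE nij) addbF eqxx.
subst i; right; exists (j |: I), p, r; split=> //.
- by rewrite finset.subUset finset.sub1set jJ.
- by rewrite cardsU1 jI cI.
- exact: sub.
- split; first split=> // i.
  + by rewrite !inE => /orP[/eqP->|/p0].
  + split=> i; last first.
      rewrite !inE => /orP[/eqP->|/r0//].
      by move: i2; rewrite qj; case: (r.2 j).
    move=> iJ; rewrite rE; last by apply: contra iJ; exact: (fintype.subsetP sIJ).
    rewrite (_ : (i == j) = false) ?addbF ?qx //.
    by apply: contraNF iJ => /eqP->.
  + move=> i; rewrite !inE negb_or -andbA => /and3P[nij iI' iJ].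
    by rewrite rE // (negbTE nij) addbF; apply: pq; rewrite inE iI'.
Qed.

Lemma reachableS d a f : reachable d a -> solvable d f -> reachable d.+1 (a + f).
Proof.
move=> rd sd J x T dJ; apply: (can_bind (rd J x T (ltnW dJ))) => T' _.
case=> [cT|[I [p [q [sIJ cI pT qT apq]]]]]; first by apply: can_done; left.
have [[px p0] [qx q0] pq] := apq.
have /card_gt0P[j /pq jpq] : 0 < #|J :\: I|.
  by rewrite cardsD (finset.setIidPr sIJ) cI subn_gt0.
have npq : p.1 != q.1 by apply: contraNneq jpq => ->.
case: (clashed_or_separated pT qT npq) => [cT|[i i1 i2]].
  by apply: can_done; left.
have iJI : i \in J :\: I.
  rewrite inE (zero_on_sep p0 q0 i2) /=.
  by apply: contraTT i1 => iJ; rewrite px // qx // eqxx.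
case ep: (p.2 i); case eq: (q.2 i); try by move: i2; rewrite ep eq.
- exact: (seesaw_step sd sIJ cI qT pT (antipodal_sinksC apq) iJI).
- exact: (seesaw_step sd sIJ cI pT qT apq iJI).
Qed.
End Can.

(** * The game on the 4-cube, decided by computation *)

(** The negation of a clash, on lists of booleans so that it evaluates. *)
Fixpoint separated (u v a b : seq bool) : bool :=
  match u, v, a, b with
  | x :: u', y :: v', c :: a', d :: b' =>
      if x (+) y then if c (+) d then true else separated u' v' a' b'
      else separated u' v' a' b'
  | _, _, _, _ => false
  end.

(* The unqueried vertices of the 4-cube, each with the answers that neither make
   it a sink nor clash with an earlier answer. *)
Definition position := seq (seq bool * seq (seq bool)).

Definition answer (L : position) u a : position :=
  [seq (r.1, [seq b <- r.2 | separated u r.1 a b]) | r <- L & r.1 != u].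

(* The i-th entry of [cands] restricts the search for the i-th query. *)
Fixpoint win (cands : seq (seq (seq bool))) (L : position) : bool :=
  if cands is c :: cands' then
    if has (fun r => nilp r.2) L then true else
    has (fun r => if r.1 \in c then all (fun a => win cands' (answer L r.1 a)) r.2
                  else false) L
  else false.

Fixpoint cube k : seq (seq bool) :=
  if k is k'.+1 then [seq b :: v | v <- cube k', b <- [:: false; true]] else [:: [::]].
Arguments cube : simpl never.

Definition start : position := [seq (v, [seq a <- cube 4 | true \in a]) | v <- cube 4].

(* The last list is empty because the last query must be at a vertex without
   admissible answers, which [win] looks for first. *)
Definition candidates : seq (seq (seq bool)) :=
  let o := false in let i := true in
  [:: [:: [:: i; i; o; o]]; [:: [:: o; o; i; i]];
      [:: [:: i; o; i; o]; [:: i; o; o; i]; [:: o; i; i; o]; [:: o; i; o; i]];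
      cube 4; [::]].

Definition wins_after a b : bool :=
  win candidates (answer (answer start (nseq 4 false) a) (nseq 4 true) b).

(** Seven counts 0000, 1111 and the five queries of [candidates]. Permuting coordinates sorts the
    answer at 0000; [k = 0] would be a sink. *)
Definition seven_steps : bool :=
  all (fun k => let a := nseq k true ++ nseq (4 - k) false in
    all (fun b => if true \in b then
                    if separated (nseq 4 false) (nseq 4 true) a b
                    then wins_after a b else true
                  else true) (cube 4)) (iota 1 4).

Lemma seven_stepsP : seven_steps.
Proof. exact: erefl. Qed.

Lemma mem_cube k v : (v \in cube k) = (size v == k).
Proof.
elim: k v => [|k IH] v; first by case: v.
apply/allpairsPdep/idP => [[w [b [+ _ ->]]]|]; first by rewrite IH.
by case: v => // b v; rewrite eqSS -IH => vk; exists v, b; split=> //; case: b.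
Qed.

Lemma separated_map n (s : seq 'I_n) u v (y z : bits n) i :
    size u = size s -> size v = size s -> i \in s ->
    nth false u (index i s) != nth false v (index i s) -> y i != z i ->
  separated u v [seq y i | i <- s] [seq z i | i <- s].
Proof.
elim: s u v => [|c s IH] [|b u] [|b' v] //= [su] [sv].
rewrite inE; case: eqVneq => [-> _|_ /= ics nuv yz].
  by rewrite !negb_eqb => -> ->.
by rewrite (IH _ _ su sv ics nuv yz); case: ifP => // _; case: ifP.
Qed.

(** * The outmap inherited by the cube of parallel [I]-faces *)

Section Inherited.
Variables (n : nat) (I J : {set 'I_n}) (x : bits n) (base : bits n) (cs : seq 'I_n).
Variable k : nat.
Hypothesis sIJ : I \subset J.
Hypothesis csE : cs =i J :\: I.
Hypothesis cs_uniq : uniq cs.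
Hypothesis baseE : agree_off J x base.
Hypothesis solve_face : forall y T, can (solved I y) k T.
Implicit Types (L : position) (T : transcript n).

(** Off [cs], [index] is [size cs], so for [u] of that length the default [false] leaves [base]
    unchanged. *)
Definition point (u : seq bool) : bits n :=
  [ffun i => base i (+) nth false u (index i cs)].

Definition response (p : bits n * bits n) : seq bool := [seq p.2 i | i <- cs].

Lemma point_off u i : size u = size cs -> i \notin J -> point u i = base i.
Proof.
move=> su iJ; have ics : i \notin cs by rewrite csE inE negb_and (negbTE iJ) orbT.
by rewrite ffunE nth_default ?addbF // memNindex ?su.
Qed.

(** Both answers vanish on [I], so only a coordinate of [cs] could separate the sinks, and there
    they have the entries of [u] and [v]. *)
Lemma face_sinks_clash T u v p q :
    size u = size cs -> size v = size cs -> u != v -> p \in T -> q \in T ->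
    face_sink I (point u) p -> face_sink I (point v) q ->
    ~~ separated u v (response p) (response q) ->
  clashed T.
Proof.
move=> su sv nuv pT qT [pu p0] [qv q0] nsep.
have npq : p.1 != q.1.
  apply: contraNneq nuv => e; apply/eqP/(@eq_from_nth _ false); first by rewrite su.
  (* The [tnth] term is only a default for [nth], since ['I_n] has no canonical element. *)
  move=> i; rewrite su => ics; have ncs := mem_nth (tnth (in_tuple cs) (Ordinal ics)) ics.
  set j := nth _ _ _ in ncs.
  have jI : j \notin I by move: ncs; rewrite csE inE => /andP[].
  have := pu j jI; rewrite e qv // !ffunE index_uniq //.
  by move/addbI.
case: (clashed_or_separated pT qT npq) => // -[i i1 i2].
have iI := zero_on_sep p0 q0 i2.
have uvi : nth false u (index i cs) != nth false v (index i cs).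
  by apply: contraNneq i1 => e; rewrite pu // qv // !ffunE e.
have ics : i \in cs.
  by apply: contraNT uvi => ics; rewrite !nth_default // memNindex // ?su ?sv.
by rewrite (separated_map su sv ics uvi i2) in nsep.
Qed.

(* Any answer at a face sink that is not listed in [L] wins at once. *)
Definition tracks L T := forall r, r \in L -> size r.1 = size cs /\
  forall T' p, {subset T <= T'} -> p \in T' -> face_sink I (point r.1) p ->
    response p \notin r.2 -> solved J x T'.

Lemma tracks_sub L T T' : {subset T <= T'} -> tracks L T -> tracks L T'.
Proof.
move=> sub tL r /tL[? tr]; split=> // T'' p sub'; apply: tr => q qT.
by apply: sub'; exact: sub.
Qed.

(** A response newly struck from the list would clash with [p]. *)
Lemma tracks_answer L T u p : size u = size cs -> tracks L T -> p \in T ->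
  face_sink I (point u) p -> tracks (answer L u (response p)) T.
Proof.
move=> su tL pT pu _ /mapP[r + ->]; rewrite mem_filter => /andP[nru rL] /=.
have [sr tr] := tL r rL; split=> // T' q sub qT qr.
rewrite mem_filter negb_and => /orP[nsep|]; last exact: tr.
by left; apply: (face_sinks_clash su sr _ _ qT pu qr nsep); [rewrite eq_sym|exact: sub].
Qed.

Lemma win_can cands L T : win cands L -> tracks L T ->
  can (solved J x) (size cands * k) T.
Proof.
elim: cands L T => [//|c cands IH] L T; rewrite mulSn.
move=> winL tL.
(* A query of the small game is a search in one [I]-face, at cost [k]. *)
have ask r : r \in L -> (forall a, a \in r.2 -> win cands (answer L r.1 a)) ->
    can (solved J x) (k + size cands * k) T.
  move=> rL wr; have [sr tr] := tL r rL.
  apply: (can_bind (solve_face (point r.1) T)) => T' sub.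
  case=> [cT|[p pT pr]]; first by apply: can_done; left.
  have [pa|pa] := boolP (response p \in r.2).
    apply: IH (wr _ pa) _; apply: tracks_answer => //; exact: tracks_sub tL.
  by apply: can_done; exact: tr pa.
move: winL => /=; case: ifP => [/hasP[r rL /nilP r0] _|_ /hasP[r rL]].
  by apply: (ask r rL) => a; rewrite r0.
by case: ifP => // _ /allP; exact: ask.
Qed.

Lemma tracks_start T : size cs = 4 -> tracks start T.
Proof.
move=> cs4 _ /mapP[v + ->]; rewrite mem_cube => /eqP sv.
split=> [|T' p sub pT [pv p0]]; first by rewrite cs4.
rewrite [in X in _ \notin X]/snd mem_filter mem_cube size_map cs4 eqxx andbT => nt.
(* A response without [true] vanishes on [J :\: I], so the sink of the [I]-face is a sink of the
   [J]-face. *)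
right; exists p => //; split=> i iJ.
  have iI : i \notin I by apply: contra iJ; exact: (fintype.subsetP sIJ).
  by rewrite pv // point_off ?baseE ?cs4.
have [/p0//|iI] := boolP (i \in I).
apply: contraNF nt => pi; rewrite -[X in X \in _]pi; apply: map_f.
by rewrite csE inE iI.
Qed.
End Inherited.

(** * From antipodal faces to a face four dimensions larger *)

Lemma sorted_response n (y : bits n) (s : seq 'I_n) :
  let cs := [seq i <- s | y i] ++ [seq i <- s | ~~ y i] in
  [seq y i | i <- cs] = nseq (count y s) true ++ nseq (size s - count y s) false.
Proof.
have cst (P : pred 'I_n) b : (forall i, P i -> y i = b) ->
    [seq y i | i <- s & P i] = nseq (count P s) b.
  move=> Pb; rewrite -size_filter -(size_map y).
  apply/all_pred1P/allP => _ /mapP[i + ->] /=.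
  by rewrite mem_filter => /andP[/Pb-> _].
move=> /=; rewrite map_cat (cst y true) // (cst (predC y) false) => [|i /negbTE//].
by rewrite -(count_predC y s) addKn.
Qed.

Lemma antipodal_solved n (J : {set 'I_n}) (x : bits n) d k T : @solvable n d k ->
  #|J| = d + 4 -> antipodal J x d T -> can (solved J x) (5 * k) T.
Proof.
move=> sd cJ [cT|[I [p [q [sIJ cI pT qT [[px p0] [qx q0] pq]]]]]].
  by apply: can_done; left.
(* Listing first the coordinates that are outgoing at [p] leaves only four
   answers to consider at 0000. *)
pose s := enum (J :\: I).
pose cs := [seq i <- s | p.2 i] ++ [seq i <- s | ~~ p.2 i].
have perm_cs : perm_eq cs s by rewrite perm_filterC.
have csE : cs =i J :\: I by move=> i; rewrite (perm_mem perm_cs) mem_enum.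
have cs_uniq : uniq cs by rewrite (perm_uniq perm_cs) enum_uniq.
have s4 : size s = 4.
  by rewrite -cardE cardsD (finset.setIidPr sIJ) cI cJ addKn.
have cs4 : size cs = 4 by rewrite (perm_size perm_cs).
have solve_face y T' : can (solved I y) k T' by exact: sd.
(* With base [p.1], the face of [p] sits at 0000 and, by antipodality, that of [q] at 1111. *)
have pu : face_sink I (point p.1 cs (nseq 4 false)) p.
  by split=> // i _; rewrite ffunE nth_nseq if_same addbF.
have qu : face_sink I (point p.1 cs (nseq 4 true)) q.
  split=> // i iI; rewrite ffunE nth_nseq -cs4 index_mem csE inE iI /=.
  case: ifP => iJ; last by rewrite addbF px ?iJ // qx ?iJ.
  by have := pq i; rewrite inE iI => /(_ iJ); case: (p.1 i); case: (q.1 i).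
have su (b : bool) : size (nseq 4 b) = size cs by rewrite size_nseq cs4.
have ts := tracks_start sIJ csE px T cs4.
have is_sink b r : r \in T -> face_sink I (point p.1 cs (nseq 4 b)) r ->
    true \notin response cs r -> solved J x T.
  move=> rT ru nr; have vin : nseq 4 b \in cube 4 by rewrite mem_cube size_nseq.
  have [_ tr] := ts _ (map_f (fun v => (v, [seq a <- cube 4 | true \in a])) vin).
  by apply: (tr T r) => //; rewrite mem_filter (negbTE nr).
have [pt|/(is_sink _ _ pT pu)] := boolP (true \in response cs p); last exact: can_done.
have [qt|/(is_sink _ _ qT qu)] := boolP (true \in response cs q); last exact: can_done.
have [sep|] := boolP (separated (nseq 4 false) (nseq 4 true)
                       (response cs p) (response cs q)); last first.
  move=> nsep; apply: can_done; left.
  exact: (face_sinks_clash csE cs_uniq (su false) (su true) isT pT qT pu qu nsep).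
have tp := tracks_answer csE cs_uniq (su false) ts pT pu.
have tq := tracks_answer csE cs_uniq (su true) tp qT qu.
apply: (win_can (cands := candidates) csE cs_uniq solve_face _ tq).
have pE : response cs p = nseq (count p.2 s) true ++ nseq (4 - count p.2 s) false.
  by rewrite /response sorted_response s4.
have cp : count p.2 s \in iota 1 4.
  rewrite mem_iota -s4 add1n ltnS count_size andbT lt0n.
  by apply: contraTneq pt; rewrite pE => ->; rewrite mem_nseq.
have qc : response cs q \in cube 4 by rewrite mem_cube size_map cs4.
by move/allP: seven_stepsP => /(_ _ cp) /allP /(_ _ qc); rewrite -pE qt sep.
Qed.

Lemma solvable_game n d a k : @reachable n d a -> @solvable n d k ->
  @solvable n (d + 4) (a + 5 * k).
Proof.
move=> rd sd J x T cJ; have dJ : d <= #|J| by rewrite cJ leq_addr.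
by apply: (can_bind (rd J x T dJ)) => T' _; exact: antipodal_solved sd cJ.
Qed.

(** * From games to algorithms *)

(** The disjunct [p \in [::]] matches what [can_algorithm] yields from an empty transcript. *)
Lemma solved_setT n (s : outmap n) (x : bits n) T (Q : seq (bits n)) :
    solved [set: 'I_n] x T ->
    (forall p, p \in T -> p.2 = s p.1 /\ (p \in [::] \/ p.1 \in Q)) ->
  (exists2 u, u \in Q & sink s u) \/
  (exists u v, [/\ u \in Q, v \in Q & clash s u v]).
Proof.
case=> [[p [q [pT qT npq cpq]]] sT|[p pT [_ p0]] sT].
  have [ep [//|pQ]] := sT _ pT; have [eq [//|qQ]] := sT _ qT.
  by right; exists p.1, q.1; split=> //; split=> //; rewrite -ep -eq.
have [ep [//|pQ]] := sT _ pT.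
by left; exists p.1 => //; rewrite /sink -ep; apply/ffunP => i; rewrite p0 ?ffunE ?inE.
Qed.

Lemma t_le n k : @solvable n n k -> t n <= k.
Proof.
have cT : #|[set: 'I_n]%SET| = n by rewrite cardsT card_ord.
move=> /(_ _ (bzero n) [::] cT) /can_algorithm[A sA].
rewrite /t; case: ex_minnP => m _ min_m.
apply: (@leq_trans (worst_case A)).
  apply: min_m; apply/asboolP; exists A; split=> // s.
  by have [//|_ [T' sol sT']] := sA s; exact: solved_setT sol sT'.
by apply/bigmax_leqP => s _; have [] := sA s.
Qed.

End Game.

(** * The growth rate *)

Theorem lemma21 (R : realType) :
  (fun n : nat => (t n)%:R : R^o) =O_\oo (fun n : nat => (161 / 100) ^+ n : R^o).
Proof.
pose r : R := 161 / 100.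
have r1 : 1 < r by rewrite /r; lra.
have bound n d : exists a k, [/\ @reachable n d a, @solvable n d k,
    a%:R <= 4 * r ^+ d & k%:R <= 4 * (r - 1) * r ^+ d].
  elim/ltn_ind: d => d IH.
  have [k sk kd] : exists2 k, @solvable n d k & k%:R <= 4 * (r - 1) * r ^+ d.
    case: d IH => [|[|[|[|d]]]] IH.
    (* The recurrence for [F] jumps by four; below that, [2 ^ d] fits, the last case being 8 against
       about 10.2. *)
    1-4: eexists; [exact: solvable_exp|by rewrite /r; lra].
    have [|a [k [ra sk ad kd]]] := IH d; first by lia.
    exists (a + 5 * k)%N; first by rewrite -[d.+4]addn4; exact: solvable_game.
    rewrite natrD natrM.
    have rd : 0 < r ^+ d by apply: exprn_gt0; lra.
    have : 4 * r ^+ d + 5 * (4 * (r - 1) * r ^+ d) <= 4 * (r - 1) * r ^+ d.+4.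
      have -> : r ^+ d.+4 = r ^+ d * r ^+ 4 by rewrite -addn4 exprD.
      (* This is tight, 16.2 against about 16.39, and fails already for 1.6. *)
      have r4 : 4 + 20 * (r - 1) <= 4 * (r - 1) * r ^+ 4.
        by rewrite /r !exprS expr0; lra.
      have := ler_wpM2r (ltW rd) r4; lra.
    lra.
  case: d IH sk kd => [|d] IH sk kd.
    by exists 2%N, k; split=> //; [exact: reachable0|rewrite expr0; lra].
  have [//|a [l [ra sl ad ld]]] := IH d.
  exists (a + l)%N, k; split=> //; first exact: reachableS.
  rewrite natrD exprS; have := lerD ad ld; rewrite -mulrDl; lra.
have tr n : (t n)%:R <= 4 * r ^+ n.
  have [_ [k [_ /t_le tk _ kn]]] := bound n n.
  apply: le_trans (_ : k%:R <= _); first by rewrite ler_nat.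
  apply: le_trans kn _; rewrite ler_pM2r ?exprn_gt0 /r; lra.
apply/eqO_exP; exists 4; first by []; apply: filterE => n.
by rewrite !ger0_norm ?tr ?ler0n // exprn_ge0 // -/r; lra.
Qed.
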